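(* Let $k$ be a positive integer, let $\mathscr{C}(k)$ be the set of all Coe-semigroups containing $k$, and let $G(\mathscr{C}(k))$ be the graph with vertex set $\mathscr{C}(k)$ in which $(S,T)\in\mathscr{C}(k)\times\mathscr{C}(k)$ is an edge if $T=S\cup\{F(S)-1,F(S)\}$. Then $G(\mathscr{C}(k))$ is a tree with root $\mathbb{N}$. Furthermore, if $S\in\mathscr{C}(k)$, then the set of sons of $S$ in the tree $G(\mathscr{C}(k))$ is equal to: (1) $\{S\setminus\{x\}\mid x\text{ is an odd element of }\mathrm{msg}(S)\text{ with }x>F(S)\text{ and }x\neq k\}$, if $\{F(S)+1,F(S)+2\}\nsubseteq\mathrm{msg}(S)\setminus\{k\}$; (2) $\{S\setminus\{x\}\mid x\text{ is an odd element of }\mathrm{msg}(S)\text{ with }x>F(S)\text{ and }x\neq k\}\cup\{S\setminus\{F(S)+1,F(S)+2\}\}$, if $\{F(S)+1,F(S)+2\}\subseteq\mathrm{msg}(S)\setminus\{k\}$.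
   Context: $\mathbb{N}=\{0,1,2,\ldots\}$. A numerical semigroup is a subset of $\mathbb{N}$ containing $0$, closed under addition and with finite complement in $\mathbb{N}$. A numerical semigroup $S$ is a Coe-semigroup if $\{x-1,x+1\}\subseteq S$ for every odd $x\in S$. The Frobenius number is $F(S)=\max(\mathbb{Z}\setminus S)$ (so $F(\mathbb{N})=-1$), and $\mathrm{msg}(S)$ is the (unique, finite) minimal system of generators of $S$ as a submonoid of $(\mathbb{N},+)$. A graph is a pair $(V,E)$ with $V$ a nonempty set and $E\subseteq\{(u,v)\mid u,v\in V,\ u\neq v\}$ (edges are ordered pairs of distinct vertices). A path of length $n$ connecting $u$ and $v$ is a sequence of $n$ distinct edges $(v_0,v_1),\ldots,(v_{n-1},v_n)$ with $v_0=u$, $v_n=v$. A graph is a tree with root $r$ if for every vertex $v\neq r$ there exists a unique path connecting $v$ and $r$. If $(u,v)$ is an edge of a tree, $u$ is called a son of $v$. *)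

(* Defs.v *)
From mathcomp Require Import all_boot all_order all_algebra.
From mathcomp Require Import boolp classical_sets cardinality.

Set Implicit Arguments.
Unset Strict Implicit.
Unset Printing Implicit Defensive.

Import Order.TTheory GRing.Theory Num.Theory.

Local Open Scope ring_scope.
Local Open Scope classical_set_scope.

Definition submonoid (M : set nat) : Prop :=
  M 0%N /\ forall x y, M x -> M y -> M (x + y)%N.

Definition numerical_semigroup (S : set nat) : Prop :=
  submonoid S /\ finite_set (~` S).

Definition coe_semigroup (S : set nat) : Prop :=
  numerical_semigroup S /\
  forall x, odd x -> S x -> [set x.-1; x.+1] `<=` S.

Definition coe_containing (k : nat) : set (set nat) :=
  [set S | coe_semigroup S /\ S k].

(* A subset of nat seen as a subset of int. *)
Definition toZ (A : set nat) : set int := Posz @` A.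

Definition maximum (A : set int) : set int := A `&` ubound A.

(* The complement is taken in int, so that F(N) = -1. The default value of xget
   is irrelevant: for a numerical semigroup the maximum exists and is unique. *)
Definition frobenius (S : set nat) : int := xget 0 (maximum (~` toZ S)).

(* The submonoid of (nat, +) generated by A. *)
Definition generated (A : set nat) : set nat := smallest submonoid A.

Definition minimal_system_of_generators (S A : set nat) : Prop :=
  generated A = S /\ forall B, B `<=` A -> generated B = S -> B = A.

(* Every submonoid of (nat, +) has exactly one minimal system of generators, so
   the default value of xget is irrelevant. *)
Definition msg (S : set nat) : set nat :=
  xget set0 (minimal_system_of_generators S).

Definition is_graph (T : Type) (V : set T) (E : set (T * T)) : Prop :=
  V !=set0 /\ forall u v, E (u, v) -> [/\ V u, V v & u <> v].

Fixpoint walk (T : Type) (E : set (T * T)) (u v : T) (p : seq (T * T)) : Prop :=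
  if p is e :: p' then [/\ E e, e.1 = u & walk E e.2 v p'] else u = v.

(* A path is given by its sequence of distinct edges; its length is size p. *)
Definition graph_path (T : eqType) (E : set (T * T)) (u v : T)
    (p : seq (T * T)) : Prop :=
  walk E u v p /\ uniq p.

Definition is_tree (T : eqType) (V : set T) (E : set (T * T)) (r : T) : Prop :=
  [/\ is_graph V E, V r &
      forall v, V v -> v <> r -> exists! p, graph_path E v r p].

Definition sons (T : Type) (E : set (T * T)) (v : T) : set T :=
  [set u | E (u, v)].

(* The equality T = S u {F(S) - 1, F(S)} is stated between subsets of int:
   F(S) - 1 and F(S) are negative when S is the whole of nat, and then no T
   satisfies it. *)
Definition coe_edges (k : nat) : set (set nat * set nat) :=
  [set e | [/\ coe_containing k e.1, coe_containing k e.2 &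
    toZ e.2 = toZ e.1 `|` [set frobenius e.1 - 1; frobenius e.1]]].

Definition removable_odd_generators (k : nat) (S : set nat) : set nat :=
  [set x | [/\ odd x, msg S x, frobenius S < x%:Z & x <> k]].

(* The naturals among F(S) + 1 and F(S) + 2; these are both natural numbers,
   since F(S) >= -1. *)
Definition next_two (S : set nat) : set nat :=
  [set x : nat | x%:Z = frobenius S + 1 \/ x%:Z = frobenius S + 2].

(* Main.v *)
(* A Coe-semigroup S other than N has an odd Frobenius number F, because an odd
   F + 1 in S would force F into S.  Hence S u {F - 1, F} is again a
   Coe-semigroup, with a smaller Frobenius number, and every S <> N has exactly
   one parent.  Conversely, if T is a son of S, then either F(T) - 1 is in T and
   T = S \ {F(T)}, or F(T) - 1 is not in T; then F(T) - 2 is not in T either, so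
   F(S) = F(T) - 2 and T = S \ {F(S) + 1, F(S) + 2}.  What may be removed is
   controlled by msg(S) being the set of irreducible elements of S. *)
Require Import Defs.
From mathcomp Require Import all_boot all_order all_algebra.
From mathcomp Require Import boolp classical_sets cardinality.
From mathcomp Require Import zify.

Set Implicit Arguments.
Unset Strict Implicit.
Unset Printing Implicit Defensive.

Import Order.TTheory.

Local Open Scope ring_scope.
Local Open Scope classical_set_scope.

(** * Trees given by a parent relation *)

(** Each non-root vertex has exactly one outgoing edge and [mu] drops along it, so following parents
    must stop, and can stop only at [r]. *)
Lemma is_tree_parent (T : eqType) (V : set T) (E : set (T * T)) (r : T)
    (mu : T -> nat) :
  V r -> (forall u v, E (u, v) -> V u /\ V v) ->
  (forall u v, E (u, v) -> (mu v < mu u)%N) ->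
  (forall u v w, E (u, v) -> E (u, w) -> v = w) ->
  (forall v, ~ E (r, v)) ->
  (forall u, V u -> u <> r -> exists v, E (u, v)) ->
  is_tree V E r.
Proof.
move=> Vr EV Emu Efun Er Eex; split=> //.
  split; first by exists r.
  move=> u v Euv; have [Vu Vv] := EV _ _ Euv; split=> // uv.
  by have := Emu _ _ Euv; rewrite uv ltnn.
have walk_mu u p : walk E u r p -> forall e, e \in p -> (mu e.1 <= mu u)%N.
  elim: p u => // -[a b] p IH u /= [Eab <- Wb] e.
  rewrite inE => /orP[/eqP-> //|ep].
  exact: leq_trans (IH _ Wb _ ep) (ltnW (Emu _ _ Eab)).
(* If the first edge [(a, b)] occurred again after [b], [walk_mu] would give [mu a <= mu b]. *)
have walk_uniq u p : walk E u r p -> uniq p.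
  elim: p u => // -[a b] p IH u /= [Eab _ Wb]; rewrite (IH _ Wb) andbT.
  by apply/negP => /(walk_mu _ _ Wb) /=; rewrite leqNgt (Emu _ _ Eab).
(* No edge leaves [r], so neither walk can end before the other. *)
have walk_inj u p q : walk E u r p -> walk E u r q -> p = q.
  elim: p u q => [|[a b] p IH] u [|[c d] q] //=.
  - by move=> -> [Ecd cr _]; case: (Er d); rewrite -cr.
  - by move=> [Eab au _] ur; case: (Er b); rewrite -ur -au.
  - move=> [Eab au Wb] [Ecd cu Wd]; subst c u.
    by have bd := Efun _ _ _ Eab Ecd; subst d; rewrite (IH _ _ Wb Wd).
have walk_ex n u : (mu u <= n)%N -> V u -> exists p, walk E u r p.
  elim: n u => [|n IH] u mun Vu.
    have [->|/eqP ur] := eqVneq u r; first by exists [::].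
    by have [v /Emu] := Eex _ Vu ur; lia.
  have [->|/eqP ur] := eqVneq u r; first by exists [::].
  have [v Euv] := Eex _ Vu ur; have muv := Emu _ _ Euv.
  have [|p Wp] := IH v _ (EV _ _ Euv).2; first lia.
  by exists ((u, v) :: p).
move=> v Vv _; have [p Wp] := walk_ex _ v (leqnn _) Vv.
exists p; split; first by split=> //; apply: walk_uniq Wp.
by move=> q [Wq _]; apply: walk_inj Wp Wq.
Qed.

(** * Minimal generators as irreducible elements *)

Definition irreducible_elements (S : set nat) : set nat :=
  [set x | [/\ S x, x <> 0%N &
    forall a b, S a -> S b -> x = (a + b)%N -> a = 0%N \/ b = 0%N]].

(** If a sum is irreducible, one summand is zero, so the sum equals the other summand, which lies
    outside [X]. *)
Lemma submonoid_setD (S X : set nat) :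
  submonoid S -> X `<=` irreducible_elements S -> submonoid (S `\` X).
Proof.
move=> [S0 SD] XI; split; first by split=> // /XI[].
move=> x y [Sx Xx] [Sy Xy]; split; first exact: SD.
move=> Xxy; have [_ _ /(_ _ _ Sx Sy erefl)[x0|y0]] := XI _ Xxy.
  by move: Xxy; rewrite x0.
by move: Xxy; rewrite y0 addn0.
Qed.

(** Strong induction: an element that is neither zero nor irreducible splits into two smaller
    elements of [S]. *)
Lemma generated_irreducible (S : set nat) :
  submonoid S -> generated (irreducible_elements S) = S.
Proof.
move=> MS; rewrite eqEsubset; split; first by move=> x; apply; split=> // y [].
move=> x Sx M [[M0 MD] IM]; have [n xn] := ubnP x.
elim: n x Sx xn => // n IH x Sx xn.
have [->//|/eqP x0] := eqVneq x 0%N.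
have [/IM//|red] := pselect (irreducible_elements S x).
suff [a [b [Sa Sb xab [/eqP a0 /eqP b0]]]] :
    exists a b, [/\ S a, S b, x = (a + b)%N & a <> 0%N /\ b <> 0%N].
  by rewrite xab; apply: MD; apply: IH => //; lia.
apply: contrapT => nex; apply: red; split=> // a b Sa Sb xab.
apply: contrapT => /not_orP ab0; apply: nex; by exists a, b.
Qed.

(** Were an irreducible [x] missing from [A], the submonoid [S] without [x] would contain [A], hence
    all of [S]. *)
Lemma irreducible_sub_generators (S A : set nat) :
  submonoid S -> generated A = S -> irreducible_elements S `<=` A.
Proof.
move=> MS genA x Ix; apply: contrapT => Ax.
have [Sx _ _] := Ix; move: (Sx); rewrite -{1}genA => /(_ (S `\ x)) [].
  split; first by apply: submonoid_setD => // y ->.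
  move=> y Ay; split; last by move=> yx; apply: Ax; rewrite -yx.
  by rewrite -genA => M [_]; apply.
by move=> _; apply.
Qed.

Lemma msgE (S : set nat) : submonoid S -> msg S = irreducible_elements S.
Proof.
move=> MS; apply: xget_unique.
  split=> [|B BI genB]; first exact: generated_irreducible.
  by rewrite eqEsubset; split=> //; apply: irreducible_sub_generators.
move=> A [genA minA]; apply/esym/minA; last exact: generated_irreducible.
exact: irreducible_sub_generators.
Qed.

(** * Frobenius numbers and largest gaps *)

Lemma toZE (A : set nat) (n : nat) : toZ A n%:Z = A n.
Proof. by apply/propext; split=> [[m Am [<-]]|An] //; exists n. Qed.

Lemma toZ_ge0 (A : set nat) (z : int) : toZ A z -> 0 <= z.
Proof. by case=> n _ <-. Qed.

Lemma toZ_inj : injective toZ.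
Proof.
by move=> A B AB; apply/seteqP; split=> n; rewrite -!toZE AB.
Qed.

Lemma toZU (A B : set nat) : toZ (A `|` B) = toZ A `|` toZ B.
Proof. exact: image_setU. Qed.

Lemma toZ_set2 (a b : nat) : toZ [set a; b] = [set a%:Z; b%:Z].
Proof. by rewrite /toZ image_setU !image_set1. Qed.

(** The Frobenius number as a natural number, available exactly when it is not -1; it keeps most
    arguments inside [nat]. *)
Definition largest_gap (S : set nat) (f : nat) : Prop :=
  ~ S f /\ forall n, (f < n)%N -> S n.

Lemma frobeniusE (S : set nat) (f : nat) :
  largest_gap S f -> frobenius S = f%:Z.
Proof.
move=> [Sf gtf]; have ub : ubound (~` toZ S) f%:Z.
  case=> n; last by lia.
  rewrite /= toZE => Sn; rewrite lez_nat leqNgt; apply/negP => /gtf.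
  exact: Sn.
apply: xget_unique; first by split=> //=; rewrite toZE.
move=> z [nz ubz]; apply/eqP; rewrite eq_le ub //=.
by apply: ubz; rewrite /= toZE.
Qed.

Lemma frobenius_setT : frobenius [set: nat] = -1.
Proof.
have ub : ubound (~` toZ [set: nat]) (-1 : int).
  case=> n; last by lia.
  by rewrite /= toZE => /(_ I).
have in1 : (~` toZ [set: nat]) (-1 : int) by move=> /toZ_ge0.
apply: xget_unique; first by split.
by move=> z [nz ubz]; apply/eqP; rewrite eq_le ub //= ubz.
Qed.

Lemma largest_gapVsetT (S : set nat) :
  finite_set (~` S) -> S = [set: nat] \/ exists f, largest_gap S f.
Proof.
move=> finS; have [[g Sg]|noS] := pselect (exists g, ~ S g); last first.
  by left; apply/seteqP; split=> // x _; apply: contrapT => Sx; apply: noS; exists x.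
right; have [s sE] := (finite_seqP (~` S)).1 finS.
have sP n : n \in s <-> ~ S n.
  by rewrite -[~ S n]/((~` S) n) sE.
have ex : exists n, n \in s by exists g; apply/sP.
have bd n : n \in s -> (n <= \max_(i <- s) i)%N.
  by move=> ns; apply: leq_bigmax_seq.
case: (ex_maxnP ex bd) => f /sP Sf maxf; exists f; split=> // n fn.
by apply: contrapT => /sP/maxf; lia.
Qed.

Lemma finite_setC_gt (S : set nat) (m : nat) :
  (forall n, (m < n)%N -> S n) -> finite_set (~` S).
Proof.
move=> gtm; apply: (@sub_finite_set _ _ `I_m.+1); last exact: finite_II.
move=> n /= Sn; rewrite ltnS leqNgt; apply/negP => /gtm; exact: Sn.
Qed.

(** * Coe-semigroups, their parents and the tree *)

Lemma coe_pred {S : set nat} {x : nat} :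
  coe_semigroup S -> odd x -> S x -> S x.-1.
Proof. by move=> [_ coeS] ox Sx; apply: (coeS x) => //; left. Qed.

Lemma coe_succ {S : set nat} {x : nat} :
  coe_semigroup S -> odd x -> S x -> S x.+1.
Proof. by move=> [_ coeS] ox Sx; apply: (coeS x) => //; right. Qed.

Lemma largest_gap_odd {S : set nat} {f : nat} :
  coe_semigroup S -> largest_gap S f -> odd f.
Proof.
move=> coeS [Sf gtf]; apply: contrapT => /negP evf; apply: Sf.
exact: (coe_pred (x := f.+1) coeS evf (gtf _ (ltnSn f))).
Qed.

Lemma coe_containing_setT (k : nat) : coe_containing k [set: nat].
Proof.
by split=> //; split=> //; split=> //; rewrite setCT.
Qed.

(** Since 1 is not in [S], adding a nonzero element of [S] to [f - 1] or [f] gives a number above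
    [f], which is in [S]. *)
Lemma coe_containing_parent (k : nat) (S : set nat) (f : nat) :
  coe_containing k S -> largest_gap S f ->
  coe_containing k (S `|` [set f.-1; f]).
Proof.
move=> [coeS Sk] gap; have of_ := largest_gap_odd coeS gap.
have [[[S0 SD] finS] _] := coeS; have [Sf gtf] := gap.
have S1 : ~ S 1%N.
  move=> S1; apply: Sf.
  by elim: (f) => // n Sn; rewrite -addn1; apply: SD.
split; last by left.
split.
- split; last by apply: (@finite_setC_gt _ f) => n /gtf; left.
  split; first by left.
  have ge2 x : S x -> x = 0%N \/ (1 < x)%N by case: x => [|[|x]] //; [left|right].
  move=> x y [Sx|xf] [Sy|yf]; first by left; apply: SD.
  + have [->|x1] := ge2 _ Sx; first by right.
    by left; apply: gtf; case: yf => /= ->; lia.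
  + have [->|y1] := ge2 _ Sy; first by rewrite addn0; right.
    by left; apply: gtf; case: xf => /= ->; lia.
  (* For [f > 2] even [2(f - 1)] exceeds [f]; for [f = 1] the sums are 0, 1 and 2. *)
  + have [f1|f1] : f = 1%N \/ (2 < f)%N by lia.
      subst f; case: xf yf => /= -> [] /= ->; rewrite ?addn0; do ?by [left|right; left|right; right].
      by left; apply: gtf.
    by left; apply: gtf; case: xf yf => /= -> [] /= ->; lia.
(* The new even number [f - 1] imposes no condition; it is the neighbour that the new odd number [f]
   requires. *)
- move=> x ox [Sx|[|]].
  + by move=> y [->|->]; left; [apply: coe_pred | apply: coe_succ].
  + by move=> /= xf; lia.
  + move=> /= -> y [|] /= ->; first by right; left.
    by left; apply: gtf.
Qed.

Lemma coe_edgesP (k : nat) (T S : set nat) :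
  coe_edges k (T, S) <->
  [/\ coe_containing k T, coe_containing k S &
      exists2 f, largest_gap T f & S = T `|` [set f.-1; f]].
Proof.
have eqZ f : coe_containing k T -> largest_gap T f ->
    toZ T `|` [set frobenius T - 1; frobenius T] = toZ (T `|` [set f.-1; f]).
  (* Oddness gives [f >= 1], so the truncated [f.-1] is the integer [f - 1]. *)
  move=> [coeT _] gap; have of_ := largest_gap_odd coeT gap.
  rewrite (frobeniusE gap) toZU toZ_set2; congr (_ `|` [set _; _]); lia.
split=> [[/= CT CS ST]|[CT CS [f gap ST]]]; last first.
  by split=> //=; rewrite (eqZ f) // ST.
split=> //; have [[[_ finT] _] _] := CT.
have [TT|[f gap]] := largest_gapVsetT finT.
  (* No edge leaves the whole of [nat]: its target would have to contain -1. *)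
  suff /toZ_ge0 : toZ S (-1) by [].
  by rewrite ST; right; right; rewrite TT /= frobenius_setT.
by exists f => //; apply: toZ_inj; rewrite ST (eqZ f).
Qed.

(** The parent contains [f] and everything above it. The lower bound makes [frobenius S + 1]
    nonnegative, so that its absolute value can serve as the measure of the tree. *)
Lemma frobenius_parent (S T : set nat) (f : nat) :
  coe_semigroup S -> largest_gap T f -> S = T `|` [set f.-1; f] ->
  -1 <= frobenius S < f%:Z.
Proof.
move=> [[_ finS] _] [Tf gtf] ST.
have [->|[g gap]] := largest_gapVsetT finS; first by rewrite frobenius_setT.
rewrite (frobeniusE gap); case: gap => Sg _.
suff : (g < f)%N by lia.
rewrite ltnNge leq_eqVlt; apply/negP => /orP[/eqP fg|/gtf Tg]; apply: Sg.
  by rewrite ST -fg; right; right.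
by rewrite ST; left.
Qed.

Lemma coe_tree (k : nat) :
  is_tree (coe_containing k) (coe_edges k) [set: nat].
Proof.
apply: (@is_tree_parent _ _ _ _ (fun S => absz (frobenius S + 1))).
- exact: coe_containing_setT.
- by move=> S T [].
- move=> T S /coe_edgesP[_ [coeS _] [f gap ST]].
  by have := frobenius_parent coeS gap ST; rewrite (frobeniusE gap); lia.
- by move=> S T U [_ _ /= ST] [_ _ /= SU]; apply: toZ_inj; rewrite ST SU.
- by move=> T /coe_edgesP[_ _ [f [nf _] _]]; apply: nf.
- move=> S CS SN; have [[[_ finS] _] _] := CS.
  have [//|[f gap]] := largest_gapVsetT finS.
  exists (S `|` [set f.-1; f]); apply/coe_edgesP; split=> //.
    exact: coe_containing_parent.
  by exists f.
Qed.

(** * Sons of a Coe-semigroup *)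

Lemma frobenius_gt (S : set nat) (n : nat) :
  finite_set (~` S) -> frobenius S < n%:Z -> S n.
Proof.
move=> /largest_gapVsetT[->//|[f gap]].
by rewrite (frobeniusE gap) => fn; apply: gap.2; lia.
Qed.

Lemma coe_son_setD1 (k : nat) (S : set nat) (x : nat) :
  coe_containing k S -> removable_odd_generators k S x ->
  coe_edges k (S `\ x, S).
Proof.
move=> CS [ox mx Fx xk]; have [coeS Sk] := CS.
have [[MS finS] _] := coeS.
rewrite msgE // in mx; have [Sx _ _] := mx.
have gtx n : (x < n)%N -> (S `\ x) n.
  move=> xn; split; last by move=> /= nx; lia.
  by apply: frobenius_gt => //; lia.
have gap : largest_gap (S `\ x) x by split=> // -[_]; apply.
apply/coe_edgesP; split=> //.
  split; last by split=> // kx; apply: xk.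
  split.
    split; first by apply: submonoid_setD => // y ->.
    exact: finite_setC_gt gtx.
  (* The neighbours of an odd [y] are even, hence different from the removed odd [x]. *)
  move=> y oy [Sy _] z [|] /= ->; split=> /=; try lia.
    exact: coe_pred.
  exact: coe_succ.
exists x => //; apply/seteqP; split=> y.
  by move=> Sy; have [->|/eqP yx] := eqVneq y x; [right; right|left].
(* The parent also adds [x - 1], which is already in [S] because [x] is odd. *)
by case=> [[]|[|]] //= ->//; apply: coe_pred.
Qed.

Lemma coe_son_setD_next_two (k : nat) (S : set nat) :
  coe_containing k S ->
  [set frobenius S + 1; frobenius S + 2] `<=` toZ (msg S `\ k) ->
  coe_edges k (S `\` next_two S, S).
Proof.
move=> CS; have [coeS Sk] := CS; have [[MS finS] _] := coeS; rewrite msgE //.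
have [SN|[f gap]] := largest_gapVsetT finS.
  (* Here [frobenius S + 1] is 0, which is not irreducible. *)
  rewrite SN frobenius_setT => /(_ 0) []; first by left.
  by move=> n [[_ n0 _] _] [].
have of_ := largest_gap_odd coeS gap.
have N2 : next_two S = [set f.+1; f.+2].
  by apply/seteqP; split=> n; rewrite /next_two /= (frobeniusE gap); lia.
rewrite (frobeniusE gap) N2.
have -> : [set f%:Z + 1; f%:Z + 2] = toZ [set f.+1; f.+2].
  by rewrite toZ_set2; congr [set _; _]; lia.
move=> sub; have {}sub : [set f.+1; f.+2] `<=` irreducible_elements S `\ k.
  by move=> n nf; rewrite -toZE; apply: sub; rewrite toZE.
set T := S `\` _.
have gtT n : (f.+2 < n)%N -> T n.
  by move=> fn; split; [apply: gap.2; lia | case=> /=; lia].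
have gapT : largest_gap T f.+2 by split=> // -[_]; apply; right.
apply/coe_edgesP; split=> //.
  split; last by split=> // /sub[_]; apply.
  split.
    split; first by apply: submonoid_setD => // y /sub[].
    exact: finite_setC_gt gtT.
  move=> y oy [Sy nf].
  (* The removed even number [f + 1] is adjacent only to [f] and [f + 2], neither of which is left;
     parity protects the neighbours of [y] from being [f + 2]. *)
  have nf1 : y <> f by move=> yf; apply: gap.1; rewrite -yf.
  have nf2 : y <> f.+2 by move=> yf; apply: nf; right.
  move=> z [|] /= ->; split=> /=; try lia.
    exact: coe_pred.
  exact: coe_succ.
exists f.+2 => //; apply/seteqP; split=> y.
  have [yf|nf] := pselect ([set f.+1; f.+2] y); first by right.
  by move=> Sy; left.
by case=> [[]//|/sub[[]]].
Qed.

Lemma coe_sons_inv (k : nat) (T S : set nat) :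
  coe_edges k (T, S) ->
  (exists2 x, removable_odd_generators k S x & T = S `\ x) \/
  ([set frobenius S + 1; frobenius S + 2] `<=` toZ (msg S `\ k) /\
   T = S `\` next_two S).
Proof.
move=> /coe_edgesP[[coeT Tk] [coeS Sk] [x gap ST]].
have of_ := largest_gap_odd coeT gap; have [Tx gtx] := gap.
have [[MT finT] _] := coeT; have [[MS finS] _] := coeS.
have TS y : S y -> ~ T y -> y = x.-1 \/ y = x by rewrite ST => -[].
have sTS y : T y -> S y by rewrite ST; left.
have Sx : S x by rewrite ST; right; right.
have Sx1 : S x.-1 by rewrite ST; right; left.
have Fx := frobenius_parent coeS gap ST.
have kx : x <> k by move=> xk; apply: Tx; rewrite xk.
rewrite /removable_odd_generators /= msgE //.
(* This makes both elements added to [T] irreducible: nonzero summands in [S] would lie in [T], and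
   so would their sum. *)
have summandT a b : S a -> S b -> b <> 0%N -> ~ T (a + b)%N -> T a.
  move=> Sa Sb b0 Tab; apply: contrapT => Ta.
  have [abx1|abx] := TS _ (MS.2 _ _ Sa Sb) Tab; have [ax1|ax] := TS _ Sa Ta;
    try lia.
  (* Only [a = x - 1] and [b = 1] remain. If 1 is in [T], then so is [x]; otherwise 1 was added,
     which by parity forces [x = 1] and [a = 0]. *)
  have b1 : b = 1%N by lia.
  have [Tb|Tb] := pselect (T b).
    by apply: Tx; elim: (x) => [|n Tn]; [|rewrite -addn1 -b1; apply: MT.2]; case: MT.
  have [bx1|bx] := TS _ Sb Tb; first by lia.
  by apply: Ta; have -> : a = 0%N; [lia | case: MT].
have irr y : S y -> ~ T y -> irreducible_elements S y.
  move=> Sy Ty; split=> //; first by move=> y0; apply: Ty; rewrite y0; case: MT.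
  move=> a b Sa Sb yab; apply: contrapT => /not_orP[a0 b0]; apply: Ty.
  rewrite yab; apply: contrapT => Tab; apply: (Tab); apply: MT.2.
    exact: summandT Tab.
  by apply: (summandT b a) => //; rewrite addnC.
have [Tx1|Tx1] := pselect (T x.-1).
  left; exists x; first by split; [|exact: irr|lia|].
  apply/seteqP; split=> y; last first.
    move=> [Sy yx]; apply: contrapT => Ty.
    by have [yx1|//] := TS _ Sy Ty; apply: Ty; rewrite yx1.
  by move=> Ty; split; [exact: sTS | move=> yx; apply: Tx; rewrite -yx].
right.
have x2 : (2 < x)%N.
  suff : x <> 1%N by lia.
  by move=> x1; apply: Tx1; rewrite x1; case: MT.
(* If the odd number [x - 2] were in [S], it would be in [T], and the Coe property would put [x - 1]
   in [T]. *)
have gapS : largest_gap S x.-2.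
  split=> [Sx2|n xn].
    apply: Tx1; have -> : x.-1 = x.-2.+1 by lia.
    apply: coe_succ => //; first by lia.
    by apply: contrapT => /(TS _ Sx2); lia.
  have [/gtx/sTS//|] := ltnP x n.
  by move=> nx; have [->//|->//] : n = x.-1 \/ n = x by lia.
rewrite (frobeniusE gapS).
have -> : next_two S = [set x.-1; x].
  by apply/seteqP; split=> n; rewrite /next_two /= (frobeniusE gapS); lia.
have -> : [set x.-2%:Z + 1; x.-2%:Z + 2] = toZ [set x.-1; x].
  by rewrite toZ_set2; congr [set _; _]; lia.
split.
  apply: image_subset => y yx; have Ty : ~ T y by case: yx => /= ->.
  split; first by apply: irr => //; case: yx => /= ->.
  (* The removed elements differ from [k] because [T] contains [k]. *)
  by move=> /= yk; apply: Ty; rewrite yk.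
apply/seteqP; split=> y.
  by move=> Ty; split; [exact: sTS | case=> /= yx; rewrite yx in Ty].
by move=> [Sy nx]; apply: contrapT => /(TS _ Sy).
Qed.

Theorem theorem20 (k : nat) (k_gt0 : (0 < k)%N) :
  is_tree (coe_containing k) (coe_edges k) [set: nat] /\
  forall S : set nat, coe_containing k S ->
    (~ ([set frobenius S + 1; frobenius S + 2] `<=` toZ (msg S `\ k)) ->
     sons (coe_edges k) S =
       [set S `\ x | x in removable_odd_generators k S]) /\
    ([set frobenius S + 1; frobenius S + 2] `<=` toZ (msg S `\ k) ->
     sons (coe_edges k) S =
       [set S `\ x | x in removable_odd_generators k S] `|`
       [set S `\` next_two S]).
Proof.
split; first exact: coe_tree.
move=> S CS; split=> next; apply/seteqP; split=> T.
- by move=> /coe_sons_inv[[x rx ->]|[]//]; exists x.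
- by move=> [x rx <-]; apply: coe_son_setD1.
- by move=> /coe_sons_inv[[x rx ->]|[_ ->]]; [left; exists x | right].
- move=> [[x rx <-]|->]; first exact: coe_son_setD1.
  exact: coe_son_setD_next_two.
Qed.
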